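(* There exists an absolute constant $c>0$ such that for all $\alpha\ge 0$, $\mu>-\frac12$, $\lambda\ge 0$, all $f\in C_B[0,\infty)$, all $n\in\mathbb{N}$ and all $x\in[0,\infty)$, $$\left|\mathcal{S}_n(f;x)-f(x)\right|\le c\,\omega_2\left(f;\tfrac12\sqrt{\Upsilon(n,x)}\right)+\omega\left(f;\Lambda_1\right),$$ where $\Upsilon(n,x)=\Lambda_1^2+\Lambda_2$, with $$\Lambda_1=\mathcal{S}_n(t-x;x)=\frac{2\alpha x^2+\lambda+1}{n},$$ $$\Lambda_2=\mathcal{S}_n((t-x)^2;x)=\frac1n\left[\frac{x^2}{n}\left(4x^2\alpha^2+4\lambda\alpha+10\alpha\right)+2x\left(\mu\frac{e_\mu(-nx)}{e_\mu(nx)}+1\right)+\frac{(\lambda+1)(\lambda+2)}{n}\right].$$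
   Context: $\mathbb{N}=\{1,2,3,\dots\}$, $\mathbb{N}_0=\mathbb{N}\cup\{0\}$, and $\Gamma$ is the Gamma function. For $\mu>-\frac12$ and $k\in\mathbb{N}_0$ put $$\gamma_\mu(2k)=\frac{2^{2k}k!\,\Gamma(k+\mu+\frac12)}{\Gamma(\mu+\frac12)},\qquad \gamma_\mu(2k+1)=\frac{2^{2k+1}k!\,\Gamma(k+\mu+\frac32)}{\Gamma(\mu+\frac12)},$$ and let $\theta_k=0$ if $k$ is even, $\theta_k=1$ if $k$ is odd. The Dunkl exponential function is $e_\mu(x)=\sum_{k=0}^\infty \frac{x^k}{\gamma_\mu(k)}$. The Dunkl generalization of the two-variable Hermite polynomials is $$h_k^\mu(\xi,\alpha)=\gamma_\mu(k)\sum_{j=0}^{\lfloor k/2\rfloor}\frac{\alpha^j\xi^{k-2j}}{j!\,\gamma_\mu(k-2j)},$$ equivalently $\sum_{k=0}^\infty \frac{h_k^\mu(\xi,\alpha)}{\gamma_\mu(k)}t^k=e^{\alpha t^2}e_\mu(\xi t)$. For $\alpha\ge0$, $\mu>-\frac12$, $\lambda\ge0$, $n\in\mathbb{N}$, $x\in[0,\infty)$ and functions $f$ on $[0,\infty)$ for which the right-hand side makes sense, define $$\mathcal{S}_n(f;x)=\frac{1}{e^{\alpha x^2}e_\mu(nx)}\sum_{k=0}^\infty\frac{h_k^\mu(n,\alpha)}{\gamma_\mu(k)}x^k\,\frac{n^{k+2\mu\theta_k+\lambda+1}}{\Gamma(k+2\mu\theta_k+\lambda+1)}\int_0^\infty t^{k+2\mu\theta_k+\lambda}e^{-nt}f(t)\,dt.$$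 In expressions such as $\mathcal{S}_n((t-x)^2;x)$ the operator acts on the function of $t$, with $x$ fixed. $C_B[0,\infty)$ is the space of continuous bounded real functions on $[0,\infty)$. For $f\in C_B[0,\infty)$ and $\delta>0$, the modulus of continuity is $\omega(f;\delta)=\sup\{|f(s)-f(t)|:\ s,t\in[0,\infty),\ |s-t|\le\delta\}$ and the second modulus of continuity is $$\omega_2(f;\delta)=\sup_{0<s\le\delta}\ \sup_{x\in[0,\infty)}\left|f(x+2s)-2f(x+s)+f(x)\right|.$$ *)

(* Defs.v *)
From HB Require Import structures.
From mathcomp Require Import all_boot all_order all_algebra.
From mathcomp Require Import all_classical all_reals all_analysis.

Set Implicit Arguments.
Unset Strict Implicit.
Unset Printing Implicit Defensive.

Import Order.TTheory GRing.Theory Num.Theory.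
Import numFieldNormedType.Exports.

Local Open Scope classical_set_scope.
Local Open Scope ring_scope.

(* Euler's integral; only meaningful for 0 < s. *)
Definition Gamma (R : realType) (s : R) : R :=
  \int[@lebesgue_measure R]_(t in `]0, +oo[) (t `^ (s - 1) * expR (- t)).

(* With m = k./2, the two cases are the values at k = 2m+1 and at k = 2m. *)
Definition dunkl_gamma (R : realType) (mu : R) (k : nat) : R :=
  let m := k./2 in
  if odd k
  then 2 ^+ (m.*2.+1) * (m`!)%:R * Gamma (m%:R + mu + 3 / 2) / Gamma (mu + 1 / 2)
  else 2 ^+ (m.*2) * (m`!)%:R * Gamma (m%:R + mu + 1 / 2) / Gamma (mu + 1 / 2).

Definition theta (R : realType) (k : nat) : R := (odd k)%:R.

Definition dunkl_exp (R : realType) (mu x : R) : R :=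
  limn (series (fun k : nat => x ^+ k / dunkl_gamma mu k)).

Definition dunkl_hermite (R : realType) (mu : R) (k : nat) (xi alpha : R) : R :=
  dunkl_gamma mu k *
  \sum_(0 <= j < (k./2).+1)
     alpha ^+ j * xi ^+ (k - j.*2) / ((j`!)%:R * dunkl_gamma mu (k - j.*2)).

(* Functions on [0, +oo[ are represented by functions on R; only the
   restriction of f to [0, +oo[ is used. *)
Definition szasz_op (R : realType) (alpha mu lambda : R) (n : nat)
    (f : R -> R) (x : R) : R :=
  (expR (alpha * x ^+ 2) * dunkl_exp mu (n%:R * x))^-1 *
  limn (series (fun k : nat =>
    let a := k%:R + 2 * mu * theta R k + lambda in
    dunkl_hermite mu k n%:R alpha / dunkl_gamma mu k * x ^+ k *
    (n%:R `^ (a + 1) / Gamma (a + 1)) *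
    \int[@lebesgue_measure R]_(t in `[0, +oo[)
       (t `^ a * expR (- (n%:R * t)) * f t))).

Definition bounded_continuous (R : realType) (f : R -> R) : Prop :=
  {within `[0, +oo[, continuous f} /\ [bounded f x | x in `[0, +oo[].

Definition omega (R : realType) (f : R -> R) (delta : R) : R :=
  sup [set r | exists s t : R,
    [/\ 0 <= s, 0 <= t, `|s - t| <= delta & r = `|f s - f t|]].

Definition omega2 (R : realType) (f : R -> R) (delta : R) : R :=
  sup [set sup [set `|f (x + 2 * s) - 2 * f (x + s) + f x| | x in `[0, +oo[]
       | s in `]0, delta]].

Definition Lambda1 (R : realType) (alpha lambda : R) (n : nat) (x : R) : R :=
  (2 * alpha * x ^+ 2 + lambda + 1) / n%:R.

Definition Lambda2 (R : realType) (alpha mu lambda : R) (n : nat) (x : R) : R :=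
  n%:R^-1 *
  (x ^+ 2 / n%:R * (4 * x ^+ 2 * alpha ^+ 2 + 4 * lambda * alpha + 10 * alpha)
   + 2 * x * (mu * (dunkl_exp mu (- (n%:R * x)) / dunkl_exp mu (n%:R * x)) + 1)
   + (lambda + 1) * (lambda + 2) / n%:R).

Definition Upsilon (R : realType) (alpha mu lambda : R) (n : nat) (x : R) : R :=
  Lambda1 alpha lambda n x ^+ 2 + Lambda2 alpha mu lambda n x.

(* Main.v *)
Require Import Defs.
From HB Require Import structures.
From mathcomp Require Import all_boot all_order all_algebra.
From mathcomp Require Import all_classical all_reals all_analysis.
From mathcomp Require Import measurable_realfun zify ring lra.

Import Order.TTheory GRing.Theory Num.Theory.
Import numFieldNormedType.Exports.

Local Open Scope classical_set_scope.
Local Open Scope ring_scope.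

(** The k-th summand of [szasz_op] averages f over a Gamma law of shape
    k + 2 mu theta_k + lambda + 1 and rate n, so S_n(f; x) = E f(T) for some T >= 0.

    Moments.  The weights h_k / gamma_k x^k are the coefficients of the product of
    exp(alpha x^2) (in even degrees) with e_mu(n x), and the index
    kappa_k = k + 2 mu theta_k satisfies kappa_(2j + i) = 2j + kappa_i.  Hence the moments
    of kappa reduce to those of the two factors, which follow from
    gamma_(k+1) = kappa_(k+1) gamma_k; the term e_mu(- n x) comes from
    theta_k = (1 - (-1)^k) / 2.

    Estimate.  No smoothing is needed.  With m = E T = x + Lambda1 and
    delta = sqrt(Upsilon) / 2, let l be the line through (m, f m) and
    (m + delta, f (m + delta)).  Going from m to t in equal steps of length at most delta
    gives |f t - l t| <= 6 omega2(f; delta) (1 + ((t - m) / delta)^2).  Taking expectations,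
    E l(T) = f m and E (T - m)^2 = Lambda2 - Lambda1^2 <= Upsilon = 4 delta^2, so c = 30
    works, the term omega(f; Lambda1) accounting for |f m - f x|. *)

(** * The Gamma function *)

Section gamma.
Context {R : realType}.
Notation mu := (@lebesgue_measure R).

(** Euler's integral kept in the extended reals, so that monotone convergence and the functional
    equation are available before finiteness is known. *)
Let J (s : R) : \bar R :=
  (\int[mu]_(t in `]0%R, +oo[) (t `^ (s - 1) * expR (- t))%:E)%E.

Lemma measurable_gamma_integrand (a c : R) (D : set R) :
  measurable_fun D (fun t : R => t `^ a * expR (- (c * t))).
Proof.
apply: (@measurable_funS _ _ _ _ setT) => //.
apply: measurable_funM => /=; first exact: measurable_powR.
apply: measurableT_comp; first exact: measurable_expR.
by apply: measurable_funN; exact: measurable_funM.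
Qed.

(** The boundary term at infinity in the integration by parts. With [s <= N], the bound
    [expR b >= b ^+ N.+1 / (N.+1)]![leaves at most](N.+1)[! / b]. *)
Lemma powR_expR_cvg0 (s : R) : n.+2%:R `^ s * expR (- n.+2%:R) @[n --> \oo] --> (0 : R).
Proof.
have [N sN] : exists N, s <= N%:R.
  by exists (Num.bound `|s|); apply/ltW; rewrite (le_lt_trans (ler_norm _))// archi_boundP.
apply: (@squeeze_cvgr _ _ _ _ (fun=> 0) (fun n => (N.+1)`!%:R * @harmonic R n)).
- near=> n; rewrite mulr_ge0 ?powR_ge0 ?expR_ge0//=.
  set b : R := n.+2%:R.
  have b0 : 0 < b by rewrite ltr0n.
  have b1 : 1 <= b by rewrite ler1n.
  rewrite expRN ler_pdivrMr ?expR_gt0//.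
  apply: (@le_trans _ _ (b ^+ N)).
    by rewrite -powR_mulrn ?(ltW b0)//; exact: ler_powR.
  apply: (@le_trans _ _ ((N.+1)`!%:R * b^-1 * (b ^+ N.+1 / (N.+1)`!%:R))).
    rewrite exprS.
    have f0 : (N.+1)`!%:R != 0 :> R by rewrite pnatr_eq0 -lt0n fact_gt0.
    have -> : (N.+1)`!%:R / b * (b * b ^+ N / (N.+1)`!%:R) = b ^+ N; last by [].
    by field; rewrite f0 gt_eqF.
  apply: ler_pM.
  - by rewrite mulr_ge0// invr_ge0 ltW.
  - by rewrite mulr_ge0// exprn_ge0// ltW.
  - by rewrite ler_pM2l ?ltr0n ?fact_gt0// /harmonic lef_pV2 ?posrE ?ltr0n// ler_nat.
  - by rewrite (le_trans _ (expR_ge1Dxn N (ltW b0)))// lerDr.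
- exact: cvg_cst.
- rewrite -[X in _ --> X](mulr0 (N.+1)`!%:R).
  by apply: cvgMl_tmp; exact: cvg_harmonic.
Unshelve. all: by end_near. Qed.

(** Compact intervals away from 0, where every real power is smooth. The shift by 2 keeps them
    nondegenerate already at [k = 0]. *)
Let bounds (k : nat) := `[(k.+2%:R)^-1, k.+2%:R]%classic : set R.

Lemma bigcup_bounds : \bigcup_k bounds k = `]0, +oo[%classic.
Proof.
apply/seteqP; split=> x /=.
  case=> k _; rewrite /bounds/= !in_itv/= andbT => /andP[+ _].
  by apply: lt_le_trans; rewrite invr_gt0.
rewrite in_itv/= andbT => x0.
have x'0 : 0 < x^-1 by rewrite invr_gt0.
exists (maxn (Num.bound x) (Num.bound x^-1)) => //.
have h y m : 0 < y -> (Num.bound y <= m)%N -> y <= m.+2%:R.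
  move=> y0 ym; apply/ltW; rewrite (lt_le_trans (archi_boundP (ltW y0)))//.
  by rewrite ler_nat !leqW.
rewrite /bounds/= in_itv/= h ?leq_maxl// andbT.
rewrite -[leRHS]invrK lef_pV2 ?posrE//.
by rewrite h// leq_maxr.
Qed.

Lemma nondecreasing_bounds : nondecreasing_seq bounds.
Proof.
move=> m n mn; rewrite subsetEset /bounds => x /=; rewrite !in_itv/= => /andP[h1 h2].
apply/andP; split.
  by rewrite (le_trans _ h1)// lef_pV2 ?posrE ?ltr0n// ler_nat.
by rewrite (le_trans h2)// ler_nat.
Qed.

Lemma gamma_cvg (s : R) :
  (\int[mu]_(t in bounds k) (t `^ (s - 1) * expR (- t))%:E)%E @[k --> \oo] --> J s.
Proof.
rewrite /J -bigcup_bounds; apply: ge0_nondecreasing_set_cvg_integral.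
- exact: nondecreasing_bounds.
- by move=> i; exact: measurable_itv.
- move=> i; apply/measurable_EFinP.
  have := @measurable_gamma_integrand (s - 1) 1 (bounds i).
  by under eq_fun do rewrite mul1r.
- by move=> i x _; rewrite lee_fin mulr_ge0 ?powR_ge0 ?expR_ge0.
Qed.

Lemma powR_continuous (s x : R) : 0 < x -> {for x, continuous (fun t : R => t `^ s)}.
Proof.
move=> x0; apply/differentiable_continuous/derivable1_diffP.
by apply: derivable_powR; rewrite in_itv/= x0.
Qed.

Lemma gamma_bounds_by_parts (s : R) k :
  (\int[mu]_(t in bounds k) (t `^ (s + 1 - 1) * expR (- t))%:E =
   (k.+2%:R^-1 `^ s * expR (- k.+2%:R^-1) - k.+2%:R `^ s * expR (- k.+2%:R))%:E
   + s%:E * \int[mu]_(t in bounds k) (t `^ (s - 1) * expR (- t))%:E)%E.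
Proof.
set a := k.+2%:R^-1; set b := k.+2%:R.
have a0 : 0 < a :> R by rewrite invr_gt0.
have ab : a < b.
  by rewrite (@lt_trans _ _ 1)// ?ltr1n// invf_lt1 ?ltr0n// ltr1n.
have cexp : continuous (fun t : R => expR (- t)).
  by move=> x; apply: continuous_comp; [exact: continuousN|exact: continuous_expR].
have cv (F : R -> R) x : {for x, continuous F} -> F @ x^'+ --> F x.
  by move=> cF; apply: cvg_at_right_filter.
have cv' (F : R -> R) x : {for x, continuous F} -> F @ x^'- --> F x.
  by move=> cF; apply: cvg_at_left_filter.
have dexp (x : R) : is_derive x 1 (fun t => - expR (- t)) (expR (- x)).
  by apply: trigger_derive; rewrite /GRing.scale/= mulrN1 opprK.
have integ : mu.-integrable `[a, b] (fun t => (t `^ (s - 1) * expR (- t))%:E).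
  apply: continuous_compact_integrable; first exact: segment_compact.
  apply: continuous_in_subspaceT => x; rewrite inE/= in_itv/= => /andP[ax _].
  apply: (@continuousM R R (fun t => t `^ (s - 1)) (fun t => expR (- t))).
    by apply: powR_continuous; exact: lt_le_trans ax.
  exact: cexp.
rewrite addrK.
have := @integration_by_parts R (fun t => t `^ s) (fun t => - expR (- t))
  (fun t => s * t `^ (s - 1)) (fun t => expR (- t)) a b ab.
rewrite /bounds -/a -/b => ->.
- rewrite !mulrN opprK; congr (_%:E + _)%E; first by rewrite addrC.
  under eq_integral do rewrite mulrN -mulrA -mulNr EFinM.
  by rewrite integralZl//= EFinN mulNe oppeK.
- apply: continuous_in_subspaceT => x; rewrite inE/= in_itv/= => /andP[ax _].
  apply: (@continuousM R R (cst s) (fun t => t `^ (s - 1))); first exact: cst_continuous.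
  by apply: powR_continuous; exact: lt_le_trans ax.
- split.
  + move=> x; rewrite in_itv/= => /andP[ax _].
    by apply: derivable_powR; rewrite in_itv/= andbT (lt_trans a0).
  + by apply: cv; exact: powR_continuous.
  + by apply: cv'; apply: powR_continuous; exact: lt_trans ab.
- move=> x; rewrite in_itv/= => /andP[ax _].
  by rewrite powR_derive1// in_itv/= andbT (lt_trans a0).
- exact: continuous_subspaceT.
- split.
  + by move=> x _; exact: ex_derive.
  + by apply: cv; apply: continuousN; exact: cexp.
  + by apply: cv'; apply: continuousN; exact: cexp.
- by move=> x _; rewrite derive1E derive_val.
Qed.

(** Pass to the limit in the truncated identity. Both boundary terms vanish, the one near 0 because
    [s > 0]. *)
Lemma gammaS_ereal (s : R) : 0 < s -> J (s + 1) = (s%:E * J s)%E.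
Proof.
move=> s0; rewrite -[RHS]add0e.
apply: (cvg_unique _ (gamma_cvg (s + 1))) => //=.
rewrite (eq_cvg _ _ (gamma_bounds_by_parts s)).
apply: cvgeD => //; last by apply: cvgeMl => //; exact: gamma_cvg.
apply: cvg_EFin; first exact: nearW.
rewrite -[X in _ --> X](subr0 (0 : R)); apply: cvgB; last exact: powR_expR_cvg0.
apply: (@squeeze_cvgr _ _ _ _ (fun=> 0) (fun n => (n.+2%:R : R)^-1 `^ s)).
- near=> n; rewrite mulr_ge0 ?powR_ge0 ?expR_ge0//=.
  by rewrite ler_piMr ?powR_ge0// -expR0 ler_expR oppr_le0 invr_ge0.
- exact: cvg_cst.
- have /cvg_at_rightP := powR_cvg0 s0; apply; split=> [n|]; first by rewrite invr_gt0.
  by have := @cvg_harmonic R; rewrite -(@cvg_shiftS R^o).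
Unshelve. all: by end_near.
Qed.

Lemma gamma1_ereal : J 1 = 1%E.
Proof.
rewrite /J subrr; under eq_integral do rewrite powRr0 mul1r.
have cexp : continuous (fun t : R => expR (- t)).
  by move=> x; apply: continuous_comp; [exact: continuousN|exact: continuous_expR].
have dexp (x : R) : is_derive x 1 (fun t => - expR (- t)) (expR (- x)).
  by apply: trigger_derive; rewrite /GRing.scale/= mulrN1 opprK.
rewrite integral_itv_obnd_cbnd//=; last first.
  apply/measurable_EFinP; apply: measurableT_comp; first exact: measurable_expR.
  exact: measurable_funN.
rewrite (@ge0_continuous_FTC2y _ _ (fun x => - expR (- x)) _ 0)//.
- by rewrite oppr0 expR0 EFinN oppeK add0e.
- exact: continuous_subspaceT.
- by rewrite -oppr0; apply: cvgN; exact: cvgr_expR.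
- by apply: cvg_at_right_filter; apply: cvgN; exact: cexp.
- by move=> x _; rewrite derive1E derive_val.
Qed.

Lemma gamma_nat_fin n : (J n.+1%:R < +oo)%E.
Proof.
elim: n => [|n IH]; first by rewrite gamma1_ereal ltry.
rewrite -natr1 gammaS_ereal ?ltr0n//.
by rewrite lte_mul_pinfty// lee_fin.
Qed.

Lemma gamma_ereal_ge0 s : (0 <= J s)%E.
Proof. by apply: integral_ge0 => x _; rewrite lee_fin mulr_ge0 ?powR_ge0 ?expR_ge0. Qed.

Lemma measurable_gamma_integrand1 (s : R) (D : set R) :
  measurable_fun D (fun t : R => (t `^ s * expR (- t))%:E).
Proof.
apply/measurable_EFinP.
have := measurable_gamma_integrand s 1 D.
by under eq_fun do rewrite mul1r.
Qed.

(** By the functional equation, finiteness at [s + 1] gives finiteness at [s]. At [s + 1] the power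
    [t]^ s[is at most]1 + t [^ N] for an integer [N >= s], which reduces the claim to integer
    arguments. *)
Lemma gamma_fin s : 0 < s -> (J s < +oo)%E.
Proof.
move=> s0; have h : (J (s + 1) < +oo)%E.
  have [N sN] : exists N, s <= N%:R.
    by exists (Num.bound `|s|); apply/ltW; rewrite (le_lt_trans (ler_norm _))// archi_boundP.
  apply: (@le_lt_trans _ _ (J 1 + J N.+1%:R)%E); last first.
    by apply: lte_add_pinfty; [rewrite gamma1_ereal ltry|exact: gamma_nat_fin].
  rewrite /J -ge0_integralD//=; first last.
  - exact: measurable_gamma_integrand1.
  - by move=> x _; rewrite lee_fin mulr_ge0 ?powR_ge0 ?expR_ge0.
  - exact: measurable_gamma_integrand1.
  - by move=> x _; rewrite lee_fin mulr_ge0 ?powR_ge0 ?expR_ge0.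
  apply: ge0_le_integral => //=.
  - by move=> x _; rewrite lee_fin mulr_ge0 ?powR_ge0 ?expR_ge0.
  - exact: measurable_gamma_integrand1.
  - by apply: emeasurable_funD; exact: measurable_gamma_integrand1.
  - move=> x; rewrite in_itv/= andbT => x0.
    rewrite -EFinD lee_fin -mulrDl ler_wpM2r ?expR_ge0//.
    rewrite -natr1 !addrK subrr powRr0.
    have [x1|/ltW x1] := leP x 1.
      rewrite (@le_trans _ _ 1)// ?lerDl ?powR_ge0//.
      by rewrite -(powRr0 x); apply: ger_powR; rewrite ?x0// ltW.
    rewrite (@le_trans _ _ (x `^ N%:R))// ?lerDr//.
    exact: ler_powR.
have := h; rewrite gammaS_ereal//.
have := gamma_ereal_ge0 s; case: (J s) => [r _ _||]//; first by rewrite ltry.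
by rewrite gt0_muley ?lte_fin// ltxx.
Qed.

(** The functional equation again moves the question to [s + 1], where the power is at least 1 on
    [[1, 2]] and the integrand at least [expR (- 2)]. *)
Lemma gamma_ereal_gt0 s : 0 < s -> (0 < J s)%E.
Proof.
move=> s0; suff : (0 < J (s + 1))%E.
  rewrite gammaS_ereal// => h.
  rewrite lt0e gamma_ereal_ge0 andbT; apply: contraL h => /eqP ->.
  by rewrite mule0 ltxx.
have E : (\int[mu]_(x in `[1%R, 2%R]) (expR (- 2))%:E = (expR (-2))%:E)%E.
  rewrite integral_cst//= lebesgue_measure_itv/= lte_fin ltr1n.
  by rewrite -EFinD (_ : 2 - 1 = 1) ?mule1//; ring.
apply: (@lt_le_trans _ _ (expR (-2))%:E); first by rewrite lte_fin expR_gt0.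
rewrite -E.
apply: (@le_trans _ _ (\int[mu]_(x in `[1%R, 2%R]) (x `^ (s + 1 - 1) * expR (- x))%:E)%E).
  apply: ge0_le_integral => //=.
  - exact: measurable_gamma_integrand1.
  - move=> x; rewrite in_itv/= => /andP[x1 x2].
    rewrite lee_fin addrK -[leLHS]mul1r ler_pM ?expR_ge0//.
      by rewrite -(powRr0 x); apply: ler_powR => //; exact: ltW.
    by rewrite ler_expR lerN2.
apply: ge0_subset_integral => //=.
- exact: measurable_gamma_integrand1.
- by move=> x _; rewrite lee_fin mulr_ge0 ?powR_ge0 ?expR_ge0.
- by move=> x /=; rewrite !in_itv/= andbT => /andP[x1 _]; exact: lt_le_trans x1.
Qed.

Let GammaE s : 0 < s -> (Gamma s)%:E = J s.
Proof.
by move=> s0; rewrite /Gamma /Rintegral fineK// ge0_fin_numE ?gamma_fin// gamma_ereal_ge0.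
Qed.

Lemma Gamma_gt0 (s : R) : 0 < s -> 0 < Gamma s.
Proof. by move=> s0; rewrite -lte_fin GammaE// gamma_ereal_gt0. Qed.

Lemma GammaS (s : R) : 0 < s -> Gamma (s + 1) = s * Gamma s.
Proof.
move=> s0; apply: EFin_inj; rewrite EFinM !GammaE ?gammaS_ereal// addr_gt0//.
Qed.

(** * Integrals of Gamma densities *)

Lemma continuous_gamma_density (a c : R) : 0 <= a ->
  {within `[0, +oo[, continuous (fun t : R => t `^ a * expR (- (c * t)))}.
Proof.
move=> a0.
have cexp : continuous (fun t : R => expR (- (c * t))).
  move=> x; apply: continuous_comp; last exact: continuous_expR.
  by apply: cvgN; apply: cvgMl_tmp; exact: cvg_id.
apply/continuous_within_itvcyP; split.
  move=> x; rewrite in_itv/= andbT => x0.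
  by apply: cvgM; [exact: powR_continuous|exact: cexp].
apply: cvgM; last by apply: cvg_at_right_filter; exact: cexp.
(* Continuity at 0 has two cases: for [a = 0] the convention that 0 to the power 0 is 1 makes the
   power constant; for [a > 0] it tends to 0. *)
move: a0; rewrite le_eqVlt => /predU1P[<-|a0].
  by under eq_fun do rewrite powRr0; rewrite powRr0; exact: cvg_cst.
by rewrite powR0 ?gt_eqF//; exact: powR_cvg0.
Qed.

(** The substitution [t := c * t] in Euler's integral. *)
Lemma integral_gamma_density (a c : R) : 0 <= a -> 0 < c ->
  (\int[mu]_(t in `[0%R, +oo[) (t `^ a * expR (- (c * t)))%:E
   = (Gamma (a + 1) / c `^ (a + 1))%:E)%E.
Proof.
move=> a0 c0.
have ca : 0 < c `^ (a + 1) by exact: powR_gt0.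
rewrite EFinM muleC GammaE ?ltr_wpDl//.
rewrite /J addrK integral_itv_obnd_cbnd//=; last first.
  exact: measurable_gamma_integrand1.
have dE : (fun t : R => c * t)^`()%classic = cst c.
  by apply/funext => t; rewrite derive1Ml// derive1_id mulr1.
have := @increasing_ge0_integration_by_substitutiony R (fun t => c * t)
  (fun t => t `^ a * expR (- t)) 0.
rewrite mulr0 => ->//; rewrite ?dE.
- rewrite [X in (_ * X)%E](_ : _ =
    (\int[mu]_(x in `[0%R, +oo[) ((c `^ (a + 1))%:E * (x `^ a * expR (- (c * x)))%:E))%E).
    rewrite ge0_integralZl_EFin//=.
    - by rewrite muleA -EFinM mulVf ?gt_eqF// mul1e.
    - by move=> x _; rewrite lee_fin mulr_ge0 ?powR_ge0 ?expR_ge0.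
    - by apply/measurable_EFinP; exact: measurable_gamma_integrand.
    - exact: ltW.
  apply: eq_integral => x; rewrite inE/= in_itv/= andbT => x0.
  rewrite -EFinM fctE/= powRM ?(ltW c0)// powRD ?(gt_eqF c0) ?implybT//.
  by rewrite powRr1 ?(ltW c0)//; congr EFin; rewrite /cst; ring.
- by move=> x y _ _; rewrite ltr_pM2l.
- by move=> x _; exact: cst_continuous.
- exact: is_cvg_cst.
- exact: is_cvg_cst.
- split; first by move=> x _; exact: derivableM.
  by apply: cvg_at_right_filter; apply: cvgMl_tmp; exact: cvg_id.
- by apply: gt0_cvgMry => //; exact: cvg_id.
- rewrite (_ : (fun t => _) = (fun t => t `^ a * expR (- (1 * t)))).
    exact: continuous_gamma_density.
  by apply/funext => t; rewrite mul1r.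
- by move=> x _; rewrite mulr_ge0 ?powR_ge0 ?expR_ge0.
Qed.

Lemma integrable_gamma_density (a c : R) : 0 <= a -> 0 < c ->
  mu.-integrable `[0, +oo[ (fun t => (t `^ a * expR (- (c * t)))%:E).
Proof.
move=> a0 c0; apply/integrableP; split.
  by apply/measurable_EFinP; exact: measurable_gamma_integrand.
under eq_integral do rewrite gee0_abs ?lee_fin ?mulr_ge0 ?powR_ge0 ?expR_ge0//.
by rewrite integral_gamma_density// ltry.
Qed.

End gamma.

(** * Series *)

Section series.
Context {R : realType}.
Implicit Types u v p : nat -> R.

Lemma cvg_seriesD u v (l m : R) :
  series u @ \oo --> l -> series v @ \oo --> m ->
  series (fun k => u k + v k) @ \oo --> l + m.
Proof.
move=> ul vm; rewrite (_ : series _ = (fun n => series u n + series v n)).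
  exact: cvgD.
by apply/funext => n; rewrite /series/= big_split.
Qed.

Lemma cvg_seriesZ (a : R) u (l : R) :
  series u @ \oo --> l -> series (fun k => a * u k) @ \oo --> a * l.
Proof.
move=> ul; rewrite (_ : series _ = (fun n => a * series u n)); first exact: cvgMl_tmp.
by apply/funext => n; rewrite /series/= mulr_sumr.
Qed.

Lemma cvg_series_recl u (l : R) :
  series (fun k => u k.+1) @ \oo --> l -> series u @ \oo --> u 0%N + l.
Proof.
move=> ul; rewrite -(@cvg_shiftS R^o).
rewrite (_ : [sequence _]_n = (fun n => u 0%N + series (fun k => u k.+1) n)).
  by apply: cvgD => //; exact: cvg_cst.
by apply/funext => n; rewrite /series/= big_nat_recl.
Qed.

Lemma series_nondecreasing u : (forall k, 0 <= u k) -> nondecreasing_seq (series u).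
Proof.
by move=> u0; apply/nondecreasing_seqP => n; rewrite seriesSr lerDl.
Qed.

(** The coefficient of [t ^+ k] in P(t^2) V(t), where P and V have coefficients [p] and [v]. *)
Definition cauchy2 p v (k : nat) := \sum_(0 <= j < (k./2).+1) p j * v (k - j.*2)%N.

(** Summation by [j] first. Letting [j] run up to [n] is harmless: once [2j >= n] the truncated
    subtraction gives 0 and the partial sum of [v] is empty. *)
Lemma series_cauchy2 p v n :
  series (cauchy2 p v) n = \sum_(0 <= j < n) p j * series v (n - j.*2)%N.
Proof.
elim: n => [|n IH]; first by rewrite /series/= !big_geq.
rewrite seriesSr IH /cauchy2.
have -> : \sum_(0 <= j < n) p j * series v (n - j.*2)%N =
          \sum_(0 <= j < n.+1) p j * series v (n - j.*2)%N.
  rewrite [RHS]big_nat_recr//= (_ : (n - n.*2 = 0)%N); last by lia.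
  by rewrite [series v 0]big_geq// mulr0 addr0.
rewrite (big_nat_widen 0 n./2.+1 n.+1) /=; last by lia.
rewrite [X in _ + X]big_mkcond/= -big_split/=; apply: eq_big_nat => j jn.
case: ifPn => jn2; first by rewrite subSn ?seriesSr ?mulrDr//; lia.
by rewrite addr0 (_ : (n.+1 - j.*2 = n - j.*2)%N)//; lia.
Qed.

(** All terms are nonnegative, so partial sums increase and stay below [P * V]. Conversely the
    partial sum of length 3n dominates the product of the two partial sums of length n, since
    [3n - 2j >= n] for [j < n]. *)
Lemma cvg_cauchy2 p v (P V : R) :
  (forall k, 0 <= p k) -> (forall k, 0 <= v k) ->
  series p @ \oo --> P -> series v @ \oo --> V ->
  series (cauchy2 p v) @ \oo --> P * V.
Proof.
move=> p0 v0 pP vV.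
have ndv := series_nondecreasing _ v0; have ndp := series_nondecreasing _ p0.
have c0 k : 0 <= cauchy2 p v k by apply: sumr_ge0 => j _; exact: mulr_ge0.
have ndc := series_nondecreasing _ c0.
have s0 u n : (forall k, 0 <= u k) -> 0 <= series u n.
  by move=> u0; apply: sumr_ge0 => k _.
have leP n : series p n <= P.
  by rewrite -(cvg_lim _ pP)//; apply: nondecreasing_cvgn_le => //; apply/cvg_ex; exists P.
have leV n : series v n <= V.
  by rewrite -(cvg_lim _ vV)//; apply: nondecreasing_cvgn_le => //; apply/cvg_ex; exists V.
have ub n : series (cauchy2 p v) n <= P * V.
  rewrite series_cauchy2 (@le_trans _ _ (series p n * V))//; last first.
    by rewrite ler_wpM2r// (le_trans (s0 _ 0%N v0)).
  rewrite /series/= mulr_suml; apply: ler_sum => j _.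
  by apply: ler_wpM2l => //; exact: leV.
have cc : cvgn (series (cauchy2 p v)).
  by apply: nondecreasing_is_cvgn => //; exists (P * V) => _ [n _ <-].
suff -> : P * V = limn (series (cauchy2 p v)) by [].
apply/eqP; rewrite eq_le; apply/andP; split; last first.
  by apply: limr_le => //; exact: nearW.
have PV : series p n * series v n @[n --> \oo] --> P * V by exact: cvgM.
rewrite -(cvg_lim _ PV)//; apply: limr_le; first by apply/cvg_ex; exists (P * V).
apply: nearW => n.
apply: (@le_trans _ _ (series (cauchy2 p v) (n + n.*2)%N)); last first.
  exact: nondecreasing_cvgn_le.
rewrite series_cauchy2 (@big_cat_nat _ _ _ n)//=; last by lia.
rewrite -[leLHS]addr0 lerD//; last first.
  by apply: sumr_ge0 => j _; rewrite mulr_ge0// s0.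
rewrite /series/= mulr_suml ler_sum_nat// => j /andP[_ jn].
by rewrite ler_wpM2l//; apply: ndv; lia.
Qed.

Section exp_moments.
Variable y : R.
Let p j : R := y ^+ j / j`!%:R.

(** Trades a factor of the index for a factor [y] and a shift, so each moment reduces to lower ones.
    [dunkl_termS] plays the same part for the Dunkl series. *)
Let pS j : j.+1%:R * p j.+1 = y * p j.
Proof.
rewrite /p exprS factS natrM invfM; field.
by rewrite nat1r !pnatr_eq0 -lt0n fact_gt0.
Qed.

Lemma cvg_exp_series : series p @ \oo --> expR y.
Proof. exact: is_cvg_series_exp_coeff. Qed.

Lemma cvg_exp_moment1 : series (fun j => j%:R * p j) @ \oo --> y * expR y.
Proof.
rewrite -[y * _]add0r -[X in X + _](mul0r (p 0)); apply: cvg_series_recl.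
by under eq_fun do rewrite pS; apply: cvg_seriesZ; exact: cvg_exp_series.
Qed.

Lemma cvg_exp_moment2 :
  series (fun j => j%:R ^+ 2 * p j) @ \oo --> y * (y * expR y + expR y).
Proof.
have -> : y * (y * expR y + expR y) = 0 ^+ 2 * p 0 + y * (y * expR y + expR y).
  by rewrite expr2 !mul0r add0r.
apply: cvg_series_recl.
have -> : (fun k => k.+1%:R ^+ 2 * p k.+1) = (fun k => y * (k%:R * p k + p k)).
  by apply/funext => k; rewrite expr2 -mulrA pS -natr1; ring.
by apply/cvg_seriesZ/cvg_seriesD; [exact: cvg_exp_moment1|exact: cvg_exp_series].
Qed.

End exp_moments.

End series.

(** * Dunkl weights *)

Section dunkl.
Context {R : realType}.
Variable mu : R.
Hypothesis mu_gt : - (1 / 2) < mu.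

Definition dunkl_idx (k : nat) : R := k%:R + 2 * mu * theta R k.

Lemma dunkl_idx_even j k : dunkl_idx (j.*2 + k) = (j.*2)%:R + dunkl_idx k.
Proof. by rewrite /dunkl_idx /theta oddD odd_double natrD addrA. Qed.

Lemma theta_succ k : theta R k.+1 = 1 - theta R k.
Proof. by rewrite /theta /=; case: (odd k); rewrite /= ?subrr ?subr0. Qed.

Lemma dunkl_gamma_gt0 k : 0 < dunkl_gamma mu k.
Proof.
have h : 0 < mu + 1 / 2 by have := mu_gt; lra.
have pos r e : 0 < r -> 0 < 2 ^+ e * (k./2)`!%:R * Gamma r / Gamma (mu + 1 / 2).
  move=> r0; apply: divr_gt0; last exact: Gamma_gt0.
  apply: mulr_gt0; last exact: Gamma_gt0.
  by rewrite mulr_gt0 ?exprn_gt0// ltr0n fact_gt0.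
by rewrite /dunkl_gamma; case: ifP => _; apply: pos; rewrite -addrA ltr_wpDl//; lra.
Qed.

Lemma dunkl_gamma0 : dunkl_gamma mu 0 = 1.
Proof.
rewrite /dunkl_gamma/= expr0 !mul1r add0r divff// gt_eqF//.
by apply: Gamma_gt0; have := mu_gt; lra.
Qed.

(** From even [k = 2m] the Gamma argument grows by one and contributes
    [2 (m + mu + 1/2) = k + 1 + 2 mu]. From odd [k = 2m + 1] the Gamma argument is unchanged and the
    factorial contributes [2 (m + 1) = k + 1]. *)
Lemma dunkl_gammaS k : dunkl_gamma mu k.+1 = dunkl_idx k.+1 * dunkl_gamma mu k.
Proof.
have h : 0 < mu + 1 / 2 by have := mu_gt; lra.
rewrite /dunkl_gamma /dunkl_idx /theta.
have -> : odd k.+1 = ~~ odd k by [].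
have kE := odd_double_half k.
case: ifPn => /= ok; rewrite ?(negbTE ok) ?(negbNE ok).
- have -> : uphalf k = k./2 by rewrite uphalf_half (negbTE ok).
  have -> : k./2%:R + mu + 3 / 2 = k./2%:R + mu + 1 / 2 + 1 by lra.
  rewrite GammaS; last by rewrite -addrA ltr_wpDl.
  have -> : k.+1%:R = 2 * k./2%:R + 1 :> R.
    by rewrite -natr1 -{1}kE (negbTE ok) add0n -mul2n natrM.
  by rewrite exprS; field; rewrite gt_eqF// Gamma_gt0.
- have ok' : odd k by rewrite (negbNE ok).
  have uk : uphalf k = k./2.+1 by rewrite uphalf_half ok'.
  rewrite uk factS natrM doubleS.
  have -> : k./2.+1%:R + mu + 1 / 2 = k./2%:R + mu + 3 / 2 by rewrite -natr1; lra.
  have -> : k.+1%:R = 2 * k./2.+1%:R :> R.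
    by rewrite -natrM -{1}kE ok'; congr (_%:R); lia.
  by rewrite exprS; field; rewrite gt_eqF// Gamma_gt0.
Qed.

(** For a positive index this is the ratio of two consecutive positive values of [dunkl_gamma],
    whatever the sign of [mu]. *)
Lemma dunkl_idx_ge0 k : 0 <= dunkl_idx k.
Proof.
case: k => [|k]; first by rewrite /dunkl_idx /theta mulr0 addr0.
by rewrite -(pmulr_lge0 _ (dunkl_gamma_gt0 k)) -dunkl_gammaS ltW// dunkl_gamma_gt0.
Qed.

Definition dunkl_term (z : R) k : R := z ^+ k / dunkl_gamma mu k.

Lemma dunkl_term_ge0 z k : 0 <= z -> 0 <= dunkl_term z k.
Proof. by move=> z0; rewrite divr_ge0 ?exprn_ge0// ltW// dunkl_gamma_gt0. Qed.

Lemma dunkl_termS z k : dunkl_idx k.+1 * dunkl_term z k.+1 = z * dunkl_term z k.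
Proof.
have g k' : dunkl_gamma mu k' != 0 by rewrite gt_eqF// dunkl_gamma_gt0.
have := g k.+1; rewrite /dunkl_term dunkl_gammaS mulf_eq0 negb_or => /andP[h _].
by rewrite exprS; field; rewrite h g.
Qed.

(** Each factor [dunkl_idx k] is at least [q * k] for [q = min(1, 1 + 2 mu)]. This dominates the
    Dunkl series at [z] by the exponential series at [|z| / q]. *)
Lemma dunkl_gamma_lower : exists2 q : R, 0 < q & forall k, q ^+ k * k`!%:R <= dunkl_gamma mu k.
Proof.
exists (Num.min 1 (1 + 2 * mu)).
  by rewrite lt_min ltr01/=; have := mu_gt; lra.
set q := Num.min _ _.
have q0 : 0 < q by rewrite lt_min ltr01/=; have := mu_gt; lra.
elim=> [|k IH]; first by rewrite dunkl_gamma0 fact0 expr0 mulr1.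
rewrite dunkl_gammaS exprS factS natrM.
have -> : q * q ^+ k * (k.+1%:R * k`!%:R) = (q * k.+1%:R) * (q ^+ k * k`!%:R) by ring.
apply: ler_pM => //.
- by rewrite mulr_ge0// ltW.
- by rewrite mulr_ge0// exprn_ge0// ltW.
have q1 : q <= 1 by rewrite ge_min lexx.
have q2 : q <= 1 + 2 * mu by rewrite ge_min lexx orbT.
rewrite /dunkl_idx /theta.
have k1 : 1 <= k.+1%:R :> R by rewrite ler1n.
case: (odd _); rewrite ?mulr0 ?addr0 ?mulr1; last by rewrite ler_piMl.
(* For odd indices the bound [q <= 1] suffices when [mu >= 0], and [q <= 1 + 2 mu] when [mu < 0]. *)
have [m0|m0] := leP 0 mu; first by nra.
nra.
Qed.

Lemma cvg_dunkl_series (z : R) : series (dunkl_term z) @ \oo --> dunkl_exp mu z.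
Proof.
suff : cvgn [normed series (dunkl_term z)] by move/normed_cvg.
have [q q0 qg] := dunkl_gamma_lower.
apply: (@series_le_cvg _ _ (exp_coeff (`|z| / q))).
- by move=> n; exact: normr_ge0.
- by move=> n; rewrite exp_coeff_ge0// divr_ge0// ltW.
- move=> n; rewrite /exp_coeff/= /dunkl_term normrM normfV normrX.
  rewrite (gtr0_norm (dunkl_gamma_gt0 n)) expr_div_n -mulrA -invfM.
  rewrite ler_wpM2l ?exprn_ge0// lef_pV2 ?posrE ?dunkl_gamma_gt0//.
  by rewrite mulr_gt0 ?exprn_gt0// ltr0n fact_gt0.
- exact: is_cvg_series_exp_coeff.
Qed.

Lemma dunkl_exp_gt0 (z : R) : 0 <= z -> 0 < dunkl_exp mu z.
Proof.
move=> z0; apply: (@lt_le_trans _ _ (series (dunkl_term z) 1)).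
  by rewrite /series/= big_nat1 /dunkl_term dunkl_gamma0 expr0 divr1.
rewrite -(cvg_lim _ (cvg_dunkl_series z))//; apply: nondecreasing_cvgn_le.
  by apply: series_nondecreasing => k; exact: dunkl_term_ge0.
by apply/cvg_ex; eexists; exact: cvg_dunkl_series.
Qed.

Lemma cvg_dunkl_moment1 (z : R) :
  series (fun k => dunkl_idx k * dunkl_term z k) @ \oo --> z * dunkl_exp mu z.
Proof.
have i0 : dunkl_idx 0 = 0 by rewrite /dunkl_idx /theta mulr0 addr0.
rewrite -[z * _]add0r -(mul0r (dunkl_term z 0)) -{1}i0; apply: cvg_series_recl.
by under eq_fun do rewrite dunkl_termS; apply: cvg_seriesZ; exact: cvg_dunkl_series.
Qed.

(** After one shift the remaining factor is [dunkl_idx k.+1 = dunkl_idx k + 1 + 2 mu (1 - 2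
    theta_k)], and the sign [1 - 2 theta_k] turns [z ^+ k] into [(- z) ^+ k]. *)
Lemma cvg_dunkl_moment2 (z : R) :
  series (fun k => dunkl_idx k ^+ 2 * dunkl_term z k) @ \oo -->
  z * (z * dunkl_exp mu z + dunkl_exp mu z + 2 * mu * dunkl_exp mu (- z)).
Proof.
have i0 : dunkl_idx 0 = 0 by rewrite /dunkl_idx /theta mulr0 addr0.
set l := (z * _).
have -> : l = dunkl_idx 0 ^+ 2 * dunkl_term z 0 + l by rewrite i0 expr2 !mul0r add0r.
apply: cvg_series_recl.
have -> : (fun k => dunkl_idx k.+1 ^+ 2 * dunkl_term z k.+1) =
  (fun k => z * (dunkl_idx k * dunkl_term z k + dunkl_term z k
                 + 2 * mu * dunkl_term (- z) k)).
  apply/funext => k; rewrite expr2 -mulrA dunkl_termS.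
  have -> : dunkl_term (- z) k = (1 - 2 * theta R k) * dunkl_term z k.
    rewrite /dunkl_term exprNn -signr_odd /theta.
    by case: (odd k); rewrite /= ?expr1 ?expr0; ring.
  rewrite /dunkl_idx theta_succ -natr1. ring.
apply/cvg_seriesZ/cvg_seriesD.
  by apply/cvg_seriesD; [exact: cvg_dunkl_moment1|exact: cvg_dunkl_series].
by apply/cvg_seriesZ; exact: cvg_dunkl_series.
Qed.

Section weights.
Variables (alpha x : R) (n : nat).
Hypotheses (alpha_ge0 : 0 <= alpha) (x_ge0 : 0 <= x).

Definition dunkl_weight k : R :=
  dunkl_hermite mu k n%:R alpha / dunkl_gamma mu k * x ^+ k.

Let y := alpha * x ^+ 2.
Let z := n%:R * x.
Let p j : R := y ^+ j / j`!%:R.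
Let v := dunkl_term z.
Let y0 : 0 <= y. Proof. by rewrite mulr_ge0// exprn_ge0. Qed.
Let z0 : 0 <= z. Proof. by rewrite mulr_ge0. Qed.
Let p0 j : 0 <= p j. Proof. by rewrite divr_ge0// exprn_ge0. Qed.
Let v0 j : 0 <= v j. Proof. exact: dunkl_term_ge0. Qed.

(** The generating function identity, coefficient by coefficient: [dunkl_gamma mu k] cancels and
    [x ^+ k] is shared out as [x ^+ j.*2 * x ^+ (k - j.*2)]. *)
Lemma dunkl_weightE : dunkl_weight = cauchy2 p v.
Proof.
have g k : dunkl_gamma mu k != 0 by rewrite gt_eqF// dunkl_gamma_gt0.
apply/funext => k; rewrite /dunkl_weight /dunkl_hermite (mulrC (dunkl_gamma _ _)) mulfK//.
rewrite mulr_suml; apply: eq_big_nat => j /andP[_ jk].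
rewrite /p /v /dunkl_term /y /z. rewrite exprMn -exprM mul2n exprMn.
have -> : x ^+ k = x ^+ j.*2 * x ^+ (k - j.*2) by rewrite -exprD; congr (_ ^+ _); lia.
field.
by rewrite g pnatr_eq0 -lt0n fact_gt0.
Qed.

Lemma dunkl_weight_ge0 k : 0 <= dunkl_weight k.
Proof. by rewrite dunkl_weightE; apply: sumr_ge0 => j _; exact: mulr_ge0. Qed.

Let E := expR y.
Let V := dunkl_exp mu z.

Lemma cvg_dunkl_weight : series dunkl_weight @ \oo --> E * V.
Proof.
rewrite dunkl_weightE; apply: cvg_cauchy2 => //; last exact: cvg_dunkl_series.
exact: cvg_exp_series.
Qed.


Lemma dunkl_weight_moment1 :
  series (fun k => dunkl_idx k * dunkl_weight k) @ \oo -->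
  (2 * y + z) * (E * V).
Proof.
rewrite dunkl_weightE.
have -> : (fun k => dunkl_idx k * cauchy2 p v k) =
  (fun k => 2 * cauchy2 (fun j => j%:R * p j) v k +
            cauchy2 p (fun j => dunkl_idx j * v j) k).
  apply/funext => k; rewrite /cauchy2 !mulr_sumr -big_split/=.
  apply: eq_big_nat => j /andP[_ jk].
  have {1}-> : k = (j.*2 + (k - j.*2))%N by lia.
  by rewrite dunkl_idx_even -mul2n natrM; ring.
have -> : (2 * y + z) * (E * V) = 2 * ((y * E) * V) + E * (z * V) by ring.
apply: cvg_seriesD.
  apply: cvg_seriesZ; apply: cvg_cauchy2 => //.
  - by move=> k; exact: mulr_ge0.
  - exact: cvg_exp_moment1.
  - exact: cvg_dunkl_series.
apply: cvg_cauchy2 => //.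
- by move=> k; rewrite mulr_ge0// dunkl_idx_ge0.
- exact: cvg_exp_series.
- exact: cvg_dunkl_moment1.
Qed.

(** Squaring [dunkl_idx k = 2j + dunkl_idx (k - 2j)] inside the convolution yields three products of
    moments already computed. *)
Lemma dunkl_weight_moment2 :
  series (fun k => dunkl_idx k ^+ 2 * dunkl_weight k) @ \oo -->
  ((2 * y + z) ^+ 2 + 4 * y + z) * (E * V) + 2 * mu * z * (E * dunkl_exp mu (- z)).
Proof.
rewrite dunkl_weightE.
have -> : (fun k => dunkl_idx k ^+ 2 * cauchy2 p v k) =
  (fun k => 4 * cauchy2 (fun j => j%:R ^+ 2 * p j) v k +
            4 * cauchy2 (fun j => j%:R * p j) (fun j => dunkl_idx j * v j) k +
            cauchy2 p (fun j => dunkl_idx j ^+ 2 * v j) k).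
  apply/funext => k; rewrite /cauchy2 !mulr_sumr -!big_split/=.
  apply: eq_big_nat => j /andP[_ jk].
  have {1}-> : k = (j.*2 + (k - j.*2))%N by lia.
  by rewrite dunkl_idx_even -mul2n natrM; ring.
set W := dunkl_exp mu (- z).
have -> : ((2 * y + z) ^+ 2 + 4 * y + z) * (E * V) + 2 * mu * z * (E * W) =
  4 * ((y * (y * E + E)) * V) + 4 * ((y * E) * (z * V)) +
  E * (z * (z * V + V + 2 * mu * W)) by ring.
apply: cvg_seriesD; first apply: cvg_seriesD.
- apply: cvg_seriesZ; apply: cvg_cauchy2 => //.
  + by move=> k; rewrite mulr_ge0// exprn_ge0.
  + exact: cvg_exp_moment2.
  + exact: cvg_dunkl_series.
- apply: cvg_seriesZ; apply: cvg_cauchy2.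
  + by move=> k; exact: mulr_ge0.
  + by move=> k; rewrite mulr_ge0// dunkl_idx_ge0.
  + exact: cvg_exp_moment1.
  + exact: cvg_dunkl_moment1.
- apply: cvg_cauchy2 => //.
  + by move=> k; rewrite mulr_ge0// exprn_ge0// dunkl_idx_ge0.
  + exact: cvg_exp_series.
  + exact: cvg_dunkl_moment2.
Qed.

End weights.
End dunkl.

(** * Second differences *)

Section second_difference.
Context {R : realType}.
Variables (f : R -> R) (d w M : R).
Hypotheses (d_gt0 : 0 < d)
  (f_bounded : forall x, 0 <= x -> `|f x| <= M)
  (f_diff2 : forall s x, 0 < s -> s <= d -> 0 <= x ->
     `|f (x + 2 * s) - 2 * f (x + s) + f x| <= w).

Let w_ge0 : 0 <= w.
Proof. by apply: le_trans (f_diff2 d 0 d_gt0 (lexx _) (lexx _)). Qed.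

(** Step 0 is added because the subdivision used later degenerates when [t = m]. *)
Let diff2 s x : 0 <= s -> s <= d -> 0 <= x ->
  `|f (x + 2 * s) - 2 * f (x + s) + f x| <= w.
Proof.
rewrite le_eqVlt => /predU1P[<- _ _|]; last exact: f_diff2.
by rewrite mulr0 !addr0 (_ : f x - 2 * f x + f x = 0) ?normr0//; ring.
Qed.

(* If e is the deviation from the chord, e vanishes at both ends and reflecting
   p in the nearest end gives 2 |e p| <= sup |e| + w. *)
Lemma chord_deviation m s : 0 <= m -> 0 <= s <= d ->
  `|f (m + s) - f m - s / d * (f (m + d) - f m)| <= w.
Proof.
move=> m0 sd; set D := f (m + d) - f m.
pose e p := f (m + p) - f m - p / d * D.
have dn0 : d != 0 by rewrite gt_eqF.
have e0 : e 0 = 0 by rewrite /e addr0 subrr !mul0r subrr.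
have ed : e d = 0 by rewrite /e divff// mul1r subrr.
(* Subtracting an affine function does not change second differences. *)
have ed2 p q : 0 <= p -> 0 <= q -> q <= d ->
    `|e (p + 2 * q) - 2 * e (p + q) + e p| <= w.
  move=> p0 q0 qd; have := diff2 q (m + p) q0 qd (addr_ge0 m0 p0).
  congr (`|_| <= w); rewrite /e !addrA.
  by field.
pose A := [set `|e p| | p in [set p | 0 <= p <= d]].
(* Boundedness of [f] makes the supremum finite, so that it can be absorbed at the end. *)
have supA : has_sup A.
  split; first by exists `|e 0|; exists 0 => //=; rewrite lexx ltW.
  exists (M + M + `|D|) => _ [p /= /andP[p0 pd] <-].
  rewrite (le_trans (ler_normB _ _))// lerD//.
    rewrite (le_trans (ler_normB _ _))// lerD// f_bounded// addr_ge0//.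
  rewrite normrM ler_piMl// ger0_norm ?(divr_ge0 _ (ltW d_gt0))//.
  by rewrite ler_pdivrMr// mul1r.
have leA p : 0 <= p <= d -> `|e p| <= sup A.
  by move=> pd; apply: (ub_le_sup supA.2); exists p.
have half p : 0 <= p <= d -> `|e p| <= (sup A + w) / 2.
  move=> /andP[p0 pd]; rewrite ler_pdivlMr//.
  rewrite (_ : `|e p| * 2 = `|2 * e p|); last by rewrite normrM ger0_norm// mulrC.
  have [p2|p2] := leP (2 * p) d.
    have h1 := ed2 0 p (lexx _) p0 pd; rewrite !add0r e0 addr0 in h1.
    have h2 := leA (2 * p); rewrite p2 mulr_ge0//= in h2.
    rewrite (_ : 2 * e p = e (2 * p) - (e (2 * p) - 2 * e p)); last by ring.
    by rewrite (le_trans (ler_normB _ _))// lerD// h2.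
  (* Beyond the midpoint the nearest end is [d]: the three points are [2p - d], [p] and [d]. *)
  have h1 := ed2 (2 * p - d) (d - p).
  rewrite (_ : 2 * p - d + 2 * (d - p) = d) in h1; last by ring.
  rewrite (_ : 2 * p - d + (d - p) = p) in h1; last by ring.
  rewrite ed in h1.
  rewrite (_ : 2 * e p = e (2 * p - d) - (0 - 2 * e p + e (2 * p - d))); last by ring.
  rewrite (le_trans (ler_normB _ _))// lerD//; last by apply: h1; lra.
  by apply: leA; lra.
have supw : sup A <= w.
  suff : sup A <= (sup A + w) / 2 by lra.
  by apply: (ge_sup supA.1) => _ [p /= pd <-]; exact: half.
exact: le_trans (leA s sd) supw.
Qed.

(** First differences drift by at most [w] per step, so the i-th differs from the initial one by at
    most [i * w]. Summing these drifts stays below [n ^+ 2 * w]. *)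
Lemma discrete_taylor (g : nat -> R) n :
  (forall i, (i.+2 <= n)%N -> `|g i.+2 - 2 * g i.+1 + g i| <= w) ->
  `|g n - g 0%N - n%:R * (g 1%N - g 0%N)| <= n%:R ^+ 2 * w.
Proof.
move=> gw.
have step i : (i.+1 <= n)%N -> `|(g i.+1 - g i) - (g 1%N - g 0%N)| <= i%:R * w.
  elim: i => [_|i IH iN]; first by rewrite subrr normr0 mul0r.
  rewrite (_ : _ - _ = (g i.+2 - 2 * g i.+1 + g i) +
    ((g i.+1 - g i) - (g 1%N - g 0%N))); last by ring.
  rewrite (_ : i.+1%:R * w = w + i%:R * w); last by rewrite -natr1; ring.
  by rewrite (le_trans (ler_normD _ _))// lerD ?gw// IH// ltnW.
suff main k : (k <= n)%N ->
    `|g k - g 0%N - k%:R * (g 1%N - g 0%N)| <= k%:R ^+ 2 * w by exact: main.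
elim: k => [_|k IH kn].
  by rewrite mul0r subrr subr0 normr0 mulr_ge0// exprn_ge0.
rewrite (_ : _ - _ = (g k - g 0%N - k%:R * (g 1%N - g 0%N)) +
   ((g k.+1 - g k) - (g 1%N - g 0%N))); last by rewrite -natr1; ring.
rewrite (le_trans (ler_normD _ _))//.
have h1 := IH (ltnW kn); have h2 := step k kn.
rewrite (le_trans (lerD h1 h2))// -mulrDl ler_wpM2r// -natr1.
by have : 0 <= k%:R :> R by []; nra.
Qed.

(** Walk from [m] to [t] in [N] equal steps of length [s <= d]. Leaving the line through the first
    step costs [N ^+ 2 * w], and comparing that step with the chord costs at most [2 * N * w], hence
    [3 * w * N ^+ 2] in all. Then [N <= 1 + r] and [(1 + r) ^+ 2 <= 2 * (1 + r ^+ 2)] give the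
    factor 6. *)
Lemma affine_approximation m t : 0 <= m -> 0 <= t ->
  `|f t - (f m + (f (m + d) - f m) / d * (t - m))| <= 6 * w * (1 + ((t - m) / d) ^+ 2).
Proof.
move=> m0 t0; set D := f (m + d) - f m.
have dn0 : d != 0 by rewrite gt_eqF.
set r := `|t - m| / d.
have r0 : 0 <= r by rewrite divr_ge0// ltW.
pose N := (Num.truncn r).+1.
have [Nr rN] : N%:R <= 1 + r /\ r <= N%:R.
  have /andP[h1 h2] := truncn_itv r0.
  by split; [rewrite -natr1 addrC lerD2l|exact: ltW].
have N0 : 0 < N%:R :> R by rewrite ltr0n.
pose s := `|t - m| / N%:R.
have s0 : 0 <= s by rewrite divr_ge0// ltW.
have sd : s <= d by rewrite ler_pdivrMr// mulrC -ler_pdivrMr.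
have Ns : N%:R * s = `|t - m| by rewrite /s mulrC divfK// gt_eqF.
have cd := chord_deviation m s m0.
rewrite s0 sd -/D in cd; have {}cd := cd isT.
suff : `|f t - (f m + D / d * (t - m))| <= 3 * w * N%:R ^+ 2.
  move=> /le_trans; apply.
  have -> : ((t - m) / d) ^+ 2 = r ^+ 2.
    by rewrite /r !expr_div_n real_normK// num_real.
  rewrite (_ : 6 * w * (1 + r ^+ 2) = 3 * w * (2 * (1 + r ^+ 2))); last by ring.
  rewrite ler_wpM2l ?mulr_ge0//.
  have : N%:R ^+ 2 <= (1 + r) ^+ 2 by rewrite lerXn2r// nnegrE ?addr_ge0// ltW.
  have := sqr_ge0 (r - 1); nra.
have N1 : 1 <= N%:R :> R by rewrite ler1n.
have Nw : N%:R * w <= N%:R ^+ 2 * w by rewrite ler_wpM2r// expr2 ler_peMr// ltW.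
have NNw : 0 <= N%:R ^+ 2 * w by rewrite mulr_ge0// exprn_ge0// ltW.
have [mt|tm] := leP m t.
- have tE : t = m + N%:R * s by rewrite Ns ger0_norm ?subr_ge0// addrC subrK.
  pose g i := f (m + i%:R * s).
  have := discrete_taylor g N.
  have gw i : (i.+2 <= N)%N -> `|g i.+2 - 2 * g i.+1 + g i| <= w.
    move=> _; have := diff2 s (m + i%:R * s) s0 sd.
    rewrite addr_ge0 ?mulr_ge0// => /(_ isT); congr (`|f _ - 2 * f _ + _| <= w).
      by rewrite -natr1 -natr1; ring.
    by rewrite -natr1; ring.
  move=> /(_ gw); rewrite /g mul0r addr0 mul1r -tE => h.
  rewrite (_ : _ - _ = (f t - f m - N%:R * (f (m + s) - f m)) +
      N%:R * (f (m + s) - f m - s / d * D)); last by rewrite {2}tE; field.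
  rewrite (le_trans (ler_normD _ _))// normrM (ger0_norm (ltW N0)).
  have h2 : N%:R * `|f (m + s) - f m - s / d * D| <= N%:R * w by rewrite ler_wpM2l// ltW.
  rewrite (le_trans (lerD h h2))//; lra.
- have tE : t = m - N%:R * s by rewrite Ns ltr0_norm ?subr_lt0//; ring.
  pose g i := f (m - i%:R * s).
  (* The walk to the left never passes [t], so it stays in the half-line where second differences
     are controlled. *)
  have ms i : (i <= N)%N -> 0 <= m - i%:R * s.
    by move=> iN; rewrite (le_trans t0)// tE lerD2l lerN2 ler_wpM2r// ler_nat.
  have := discrete_taylor g N.
  have gw i : (i.+2 <= N)%N -> `|g i.+2 - 2 * g i.+1 + g i| <= w.
    move=> iN; rewrite (_ : _ + _ =
      f (m - i.+2%:R * s + 2 * s) - 2 * f (m - i.+2%:R * s + s) + f (m - i.+2%:R * s)).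
      exact: diff2 (ms _ iN).
    rewrite /g (_ : m - i.+2%:R * s + 2 * s = m - i%:R * s); last first.
      by rewrite -natr1 -natr1; ring.
    rewrite (_ : m - i.+2%:R * s + s = m - i.+1%:R * s); last first.
      by rewrite -(natr1 i.+1); ring.
    by ring.
  move=> /(_ gw); rewrite /g mul0r subr0 mul1r -tE => h.
  (* The chord is controlled only to the right of [m]. One second difference centred at [m] reflects
     the first step, at the price of an extra [w]. *)
  have h1 := diff2 s (m - s) s0 sd.
  have ms1 : 0 <= m - s by have := ms 1%N; rewrite mul1r; apply.
  have {}h1 := h1 ms1.
  rewrite subrK (_ : m - s + 2 * s = m + s) in h1; last by ring.
  rewrite (_ : _ - _ = (f t - f m - N%:R * (f (m - s) - f m)) +
      N%:R * ((f (m + s) - 2 * f m + f (m - s)) - (f (m + s) - f m - s / d * D)));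
    last by rewrite {2}tE; field.
  rewrite (le_trans (ler_normD _ _))// normrM (ger0_norm (ltW N0)).
  have h2 : N%:R * `|(f (m + s) - 2 * f m + f (m - s)) - (f (m + s) - f m - s / d * D)|
      <= N%:R * (w + w).
    by rewrite ler_wpM2l ?(ltW N0)// (le_trans (ler_normB _ _))// lerD.
  rewrite (le_trans (lerD h h2))//; lra.
Qed.

End second_difference.

(** * Averages over a Gamma law *)

Section gamma_mean.
Context {R : realType}.
Notation leb := (@lebesgue_measure R).
Variables (a c : R).
Hypotheses (a_ge0 : 0 <= a) (c_gt0 : 0 < c).
Let D : set R := `[0, +oo[%classic.
Let dens (t : R) := t `^ a * expR (- (c * t)).
Let mD : @measurable _ (g_sigma_algebraType (R.-ocitv.-measurable)) D.
Proof. exact: measurable_itv. Qed.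
Let dens_ge0 t : 0 <= dens t. Proof. by rewrite mulr_ge0 ?powR_ge0 ?expR_ge0. Qed.

(** Expectation under the Gamma law of shape [a + 1] and rate [c]. *)
Definition gamma_mean (f : R -> R) : R :=
  c `^ (a + 1) / Gamma (a + 1) *
  \int[leb]_(t in D) (t `^ a * expR (- (c * t)) * f t).

Let densX k : {in D, (fun t => t `^ (a + k%:R) * expR (- (c * t))) =1
                     (fun t => dens t * t ^+ k)}.
Proof.
move=> t; rewrite inE /D/= in_itv/= andbT => t0; rewrite /dens.
(* Splitting the power at [t = 0] requires a nonzero total exponent, which can fail for [k = 0]. *)
case: k => [|k]; first by rewrite addr0 expr0 mulr1.
rewrite powRD; last by rewrite gt_eqF// ltr_wpDl.
by rewrite powR_mulrn//; ring.
Qed.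

Let integrable_densX k : leb.-integrable D (EFin \o (fun t => dens t * t ^+ k)).
Proof.
apply: eq_integrable (integrable_gamma_density (a + k%:R) c _ c_gt0) => //.
  by move=> t tD /=; rewrite -densX.
by rewrite addr_ge0.
Qed.

Let Rintegral_densX k :
  \int[leb]_(t in D) (dens t * t ^+ k) = Gamma (a + k%:R + 1) / c `^ (a + k%:R + 1).
Proof.
transitivity (\int[leb]_(t in D) (t `^ (a + k%:R) * expR (- (c * t)))).
  by apply: eq_Rintegral => t tD; rewrite densX.
rewrite /Rintegral integral_gamma_density//.
by rewrite addr_ge0.
Qed.

Let quad (u v w : R) (t : R) := u + v * t + w * t ^+ 2.

Let dens_quadE u v w : (fun t => dens t * quad u v w t) =
  (fun t => u * (dens t * t ^+ 0) + v * (dens t * t ^+ 1) + w * (dens t * t ^+ 2)).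
Proof. by apply/funext => t; rewrite /quad; ring. Qed.

Let integrableZ r g : leb.-integrable D (EFin \o g) ->
  leb.-integrable D (EFin \o (fun t => r * g t)).
Proof. by move=> h; apply: eq_integrable (integrableZl mD r h) => // t _; rewrite /= EFinM. Qed.

Let integrableDr g h : leb.-integrable D (EFin \o g) -> leb.-integrable D (EFin \o h) ->
  leb.-integrable D (EFin \o (fun t => g t + h t)).
Proof.
by move=> ig ih; apply: eq_integrable (integrableD mD ig ih) => // t _; rewrite /= EFinD.
Qed.

Let integrable_quad u v w : leb.-integrable D (EFin \o (fun t => dens t * quad u v w t)).
Proof.
rewrite dens_quadE; apply: integrableDr; first apply: integrableDr.
all: exact/integrableZ/integrable_densX.
Qed.

(** A factor [t ^+ k] raises the exponent of the density by [k]; the functional equation of Gamma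
    then gives the moments [(a + 1) / c] and [(a + 1) (a + 2) / c ^+ 2]. *)
Lemma gamma_mean_quadratic u v w :
  gamma_mean (fun t => u + v * t + w * t ^+ 2) =
  u + v * ((a + 1) / c) + w * ((a + 1) * (a + 2) / c ^+ 2).
Proof.
rewrite /gamma_mean -/(dens _).
have -> : (\int[leb]_(t in D) (dens t * (u + v * t + w * t ^+ 2))) =
  (\int[leb]_(t in D) (u * (dens t * t ^+ 0) + v * (dens t * t ^+ 1) + w * (dens t * t ^+ 2))).
  by apply: eq_Rintegral => t _; ring.
have iZ r k : leb.-integrable D (EFin \o (fun t => r * (dens t * t ^+ k))).
  exact/integrableZ/integrable_densX.
have iD : leb.-integrable D
    (EFin \o (fun t => u * (dens t * t ^+ 0) + v * (dens t * t ^+ 1))).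
  by apply: integrableDr; exact: iZ.
rewrite (RintegralD mD iD (iZ w 2%N)) (RintegralD mD (iZ u 0%N) (iZ v 1%N)).
rewrite !(RintegralZl _ mD (integrable_densX _)).
rewrite !Rintegral_densX addr0.
have a1 : 0 < a + 1 by rewrite ltr_wpDl.
have GS : Gamma (a + 1 + 1) = (a + 1) * Gamma (a + 1) by rewrite GammaS.
have GSS : Gamma (a + 2 + 1) = (a + 2) * ((a + 1) * Gamma (a + 1)).
  by rewrite GammaS ?ltr_wpDl// (_ : a + 2 = a + 1 + 1) ?GS//; ring.
have PS r : c `^ (r + 1) = c `^ r * c.
  by rewrite powRD ?powRr1 ?(ltW c_gt0)// (gt_eqF c_gt0) implybT.
have PSS : c `^ (a + 2 + 1) = c `^ (a + 1) * c ^+ 2.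
  by rewrite (_ : a + 2 + 1 = a + 1 + 1 + 1) ?PS; ring.
rewrite GS GSS PSS (PS (a + 1)).
have G0 : Gamma (a + 1) != 0 by rewrite gt_eqF// Gamma_gt0.
have P0 : c `^ (a + 1) != 0 by rewrite gt_eqF// powR_gt0.
have c0 : c != 0 by rewrite gt_eqF.
by field; rewrite G0 P0 c0.
Qed.

(** Positivity of the mean: affine functions are averaged exactly, and the deviation is bounded by
    the mean of its quadratic majorant. The bound [M] provides integrability of [f]. *)
Lemma gamma_mean_approx (f : R -> R) (M A B u v w : R) :
  measurable_fun D f -> (forall t, 0 <= t -> `|f t| <= M) ->
  (forall t, 0 <= t -> `|f t - (A + B * t)| <= u + v * t + w * t ^+ 2) ->
  `|gamma_mean f - (A + B * ((a + 1) / c))| <=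
    u + v * ((a + 1) / c) + w * ((a + 1) * (a + 2) / c ^+ 2).
Proof.
move=> mf fM fq.
have itf : leb.-integrable D (EFin \o (fun t => dens t * f t)).
  apply: (@le_integrable _ _ _ leb D mD _ (EFin \o (fun t => M * (dens t * t ^+ 0)))).
  - apply/measurable_EFinP; apply: measurable_funM => //.
    exact: measurable_gamma_integrand.
  - move=> t; rewrite /D/= in_itv/= andbT => t0; rewrite lee_fin expr0 mulr1.
    rewrite mulrC !normrM ler_wpM2r//.
    by rewrite (le_trans (fM t t0))// ler_norm.
  - exact/integrableZ/integrable_densX.
rewrite -gamma_mean_quadratic.
have -> : A + B * ((a + 1) / c) = gamma_mean (fun t => A + B * t + 0 * t ^+ 2).
  by rewrite gamma_mean_quadratic mul0r addr0.
have C0 : 0 <= c `^ (a + 1) / Gamma (a + 1).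
  by rewrite divr_ge0 ?powR_ge0// ltW// Gamma_gt0// ltr_wpDl.
rewrite /gamma_mean -mulrBr normrM ger0_norm// ler_wpM2l//.
have iAB : leb.-integrable D (EFin \o (fun t => dens t * quad A B 0 t)) by exact: integrable_quad.
have iB : leb.-integrable D (EFin \o (fun t => dens t * f t - dens t * quad A B 0 t)).
  by apply: eq_integrable (integrableB mD itf iAB) => // t _; rewrite /= EFinB.
rewrite -(RintegralB mD itf iAB).
apply: (le_trans (le_normr_Rintegral mD iB)).
apply: (le_Rintegral mD _ (integrable_quad u v w)).
  exact: (integrable_norm iB).
move=> t; rewrite /D/= in_itv/= andbT => t0.
rewrite -mulrBr normrM ger0_norm// ler_wpM2l//.
by rewrite /quad mul0r addr0; exact: fq.
Qed.

End gamma_mean.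

(** * The operator *)

Section szasz.
Context {R : realType}.
Variables (alpha mu lambda x : R) (n : nat).
Hypotheses (alpha_ge0 : 0 <= alpha) (mu_gt : - (1 / 2) < mu)
  (lambda_ge0 : 0 <= lambda) (n_gt0 : (0 < n)%N) (x_ge0 : 0 <= x).

Let b := dunkl_weight mu alpha x n.
Let y := alpha * x ^+ 2.
Let z := n%:R * x.
Let V := dunkl_exp mu z.
Let G := expR y * V.
Let r := dunkl_exp mu (- z) / V.
Let idx k := dunkl_idx mu k + lambda.

Let idx_ge0 k : 0 <= idx k.
Proof. by rewrite addr_ge0// dunkl_idx_ge0. Qed.

Let nR_gt0 : 0 < n%:R :> R. Proof. by rewrite ltr0n. Qed.

Let V_gt0 : 0 < V.
Proof. by apply: dunkl_exp_gt0 => //; rewrite mulr_ge0. Qed.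

Let G_gt0 : 0 < G. Proof. by rewrite mulr_gt0// expR_gt0. Qed.

Lemma szasz_opE f : szasz_op alpha mu lambda n f x =
  G^-1 * limn (series (fun k => b k * gamma_mean (idx k) n%:R f)).
Proof.
rewrite /szasz_op; congr (_ * _).
rewrite (_ : (fun k => _) = (fun k => b k * gamma_mean (idx k) n%:R f))//.
apply/funext => k; by rewrite /= -mulrA.
Qed.

(** This and [szasz_mean2] are the closed forms of E T and E T^2. *)
Definition szasz_mean1 : R := (2 * y + z + lambda + 1) / n%:R.

Definition szasz_mean2 : R :=
  ((2 * y + z) ^+ 2 + 4 * y + z + 2 * mu * z * r
   + (2 * lambda + 3) * (2 * y + z) + (lambda + 1) * (lambda + 2)) / n%:R ^+ 2.

Lemma cvg_szasz_quadratic (u v w : R) :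
  series (fun k => b k * (u + v * ((idx k + 1) / n%:R)
                   + w * ((idx k + 1) * (idx k + 2) / n%:R ^+ 2))) @ \oo -->
  G * (u + v * szasz_mean1 + w * szasz_mean2).
Proof.
have n0 : n%:R != 0 :> R by rewrite gt_eqF.
have V0 : V != 0 by rewrite gt_eqF.
have h0 := cvg_dunkl_weight mu mu_gt alpha x n alpha_ge0 x_ge0.
have h1 := dunkl_weight_moment1 mu mu_gt alpha x n alpha_ge0 x_ge0.
have h2 := dunkl_weight_moment2 mu mu_gt alpha x n alpha_ge0 x_ge0.
(* [A], [B] and [C] are the coefficients of the k-th Gamma mean as a polynomial in [dunkl_idx mu k],
   so the three moments of the weights combine linearly. *)
pose A := u + v * ((lambda + 1) / n%:R) + w * ((lambda + 1) * (lambda + 2) / n%:R ^+ 2).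
pose B := v / n%:R + w * ((2 * lambda + 3) / n%:R ^+ 2).
pose C := w / n%:R ^+ 2.
have := cvg_seriesD _ _ _ _ (cvg_seriesD _ _ _ _ (cvg_seriesZ A _ _ h0) (cvg_seriesZ B _ _ h1))
  (cvg_seriesZ C _ _ h2).
rewrite -/b -/y -/z -/V -/G.
rewrite (_ : (fun k => _) = (fun k => b k * (u + v * ((idx k + 1) / n%:R)
                   + w * ((idx k + 1) * (idx k + 2) / n%:R ^+ 2)))); last first.
  by apply/funext => k; rewrite /A /B /C /idx; field.
congr (_ --> _).
by rewrite /A /B /C /G /szasz_mean1 /szasz_mean2 /r; field; rewrite n0 V0.
Qed.

Lemma szasz_op_quadratic (u v w : R) :
  szasz_op alpha mu lambda n (fun t => u + v * t + w * t ^+ 2) x =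
  u + v * szasz_mean1 + w * szasz_mean2.
Proof.
rewrite szasz_opE.
under eq_fun do rewrite gamma_mean_quadratic//.
by rewrite (cvg_lim _ (cvg_szasz_quadratic u v w))// mulKf// gt_eqF.
Qed.

Lemma szasz_mean1E : szasz_mean1 = x + Lambda1 alpha lambda n x.
Proof.
rewrite /szasz_mean1 /Lambda1 /y /z; field.
by rewrite gt_eqF.
Qed.

Lemma szasz_centered2E :
  szasz_mean2 - 2 * x * szasz_mean1 + x ^+ 2 = Lambda2 alpha mu lambda n x.
Proof.
rewrite /szasz_mean2 /szasz_mean1 /Lambda2 -/z -/V -/r /y /z; field.
by rewrite gt_eqF.
Qed.

(** The closed form hides the sign, so it is read off the series: each Gamma law contributes its
    squared bias [((idx k + 1) / n - x) ^+ 2] plus its variance [(idx k + 1) / n ^+ 2]. *)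
Lemma Lambda2_ge0 : 0 <= Lambda2 alpha mu lambda n x.
Proof.
have -> : Lambda2 alpha mu lambda n x =
  x ^+ 2 + (- (2 * x)) * szasz_mean1 + 1 * szasz_mean2.
  by rewrite -szasz_centered2E; ring.
rewrite -(pmulr_rge0 _ G_gt0) -(cvg_lim _ (cvg_szasz_quadratic _ _ _))//.
apply: limr_ge; first by apply/cvg_ex; eexists; exact: cvg_szasz_quadratic.
apply: nearW => N; apply: sumr_ge0 => k _.
rewrite mulr_ge0 ?dunkl_weight_ge0//.
rewrite (_ : _ + _ = ((idx k + 1) / n%:R - x) ^+ 2 + (idx k + 1) / n%:R ^+ 2).
  by rewrite addr_ge0 ?sqr_ge0// divr_ge0 ?exprn_ge0// addr_ge0.
by field; rewrite gt_eqF.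
Qed.

Lemma Lambda1_gt0 : 0 < Lambda1 alpha lambda n x.
Proof. by rewrite divr_gt0// ltr_wpDl// addr_ge0// mulr_ge0 ?exprn_ge0// mulr_ge0. Qed.

Lemma Upsilon_gt0 : 0 < Upsilon alpha mu lambda n x.
Proof. by rewrite ltr_pwDl ?Lambda2_ge0// exprn_gt0// Lambda1_gt0. Qed.

(** Sums the bounds for the individual Gamma laws. Convergence of the series for [f] comes out of
    the proof: the deviations [T k] are dominated by a convergent series, and the affine part
    converges by the moment formulas. *)
Lemma szasz_op_approx (f : R -> R) (M A B u v w : R) :
  measurable_fun (`[0, +oo[%classic : set R) f -> (forall t, 0 <= t -> `|f t| <= M) ->
  (forall t, 0 <= t -> `|f t - (A + B * t)| <= u + v * t + w * t ^+ 2) ->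
  `|szasz_op alpha mu lambda n f x - (A + B * szasz_mean1)| <=
    u + v * szasz_mean1 + w * szasz_mean2.
Proof.
move=> mf fM fq.
pose L k := A + B * ((idx k + 1) / n%:R).
pose Q k := u + v * ((idx k + 1) / n%:R) + w * ((idx k + 1) * (idx k + 2) / n%:R ^+ 2).
pose T k := b k * (gamma_mean (idx k) n%:R f - L k).
have TQ k : `|T k| <= b k * Q k.
  have b0 : 0 <= b k by exact: dunkl_weight_ge0.
  rewrite normrM ger0_norm// ler_wpM2l//.
  exact: (gamma_mean_approx _ _ (idx_ge0 k) nR_gt0 f M).
have cQ := cvg_szasz_quadratic u v w.
have cL : series (fun k => b k * L k) @ \oo --> G * (A + B * szasz_mean1).
  have := cvg_szasz_quadratic A B 0; rewrite mul0r addr0.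
  by under eq_fun do rewrite mul0r addr0.
have cTn : cvgn [normed series T].
  apply: (@series_le_cvg _ _ (fun k => b k * Q k)) => //.
  - by move=> k; exact: normr_ge0.
  - by move=> k; exact: le_trans (normr_ge0 _) (TQ k).
  - by apply/cvg_ex; eexists; exact: cQ.
have cT : cvgn (series T) by exact: normed_cvg.
have lT : `|limn (series T)| <= G * (u + v * szasz_mean1 + w * szasz_mean2).
  rewrite (le_trans (lim_series_norm cTn))// -(cvg_lim _ cQ)//.
  by apply: lim_series_le => //; apply/cvg_ex; eexists; exact: cQ.
have cF := cvg_seriesD _ _ _ _ cT cL.
rewrite szasz_opE.
have -> : (fun k => b k * gamma_mean (idx k) n%:R f) = (fun k => T k + b k * L k).
  by apply/funext => k; rewrite /T; ring.
rewrite (cvg_lim _ cF)// mulrDr mulKf ?gt_eqF// addrK.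
by rewrite normrM ger0_norm ?invr_ge0 ?(ltW G_gt0)// mulrC ler_pdivrMr// mulrC.
Qed.

End szasz.

(** * Boundedness and the moduli of continuity *)

Lemma bounded_continuousP (R : realType) (f : R -> R) : bounded_continuous f ->
  measurable_fun (`[0, +oo[%classic : set R) f /\ exists M, forall t, 0 <= t -> `|f t| <= M.
Proof.
move=> [cf bf]; split.
  by apply: subspace_continuous_measurable_fun => //; exact: measurable_itv.
(* Boundedness provides a bound only for constants strictly above [M0]. *)
case: bf => M0 [_ hM]; exists (M0 + 1) => t t0.
by apply: (hM (M0 + 1)); rewrite ?ltrDl//= in_itv/= t0.
Qed.

Lemma le_omega (R : realType) (f : R -> R) (M delta s t : R) :
  (forall t, 0 <= t -> `|f t| <= M) -> 0 <= s -> 0 <= t -> `|s - t| <= delta ->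
  `|f s - f t| <= omega f delta.
Proof.
move=> fM s0 t0 st; apply: ub_le_sup; last by exists s, t.
exists (M + M) => _ [s' [t' [s'0 t'0 _ ->]]].
by rewrite (le_trans (ler_normB _ _))// lerD// fM.
Qed.

(** Both nested suprema must be over bounded sets for [sup] to be an upper bound; every second
    difference is at most [4 * M]. *)
Lemma le_omega2 (R : realType) (f : R -> R) (M delta s x : R) :
  (forall t, 0 <= t -> `|f t| <= M) -> 0 < s -> s <= delta -> 0 <= x ->
  `|f (x + 2 * s) - 2 * f (x + s) + f x| <= omega2 f delta.
Proof.
move=> fM s0 sd x0.
have bnd s' x' : 0 < s' -> 0 <= x' ->
    `|f (x' + 2 * s') - 2 * f (x' + s') + f x'| <= M + 2 * M + M.
  move=> /ltW s'0 x'0; rewrite (le_trans (ler_normD _ _))// lerD ?fM//.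
  rewrite (le_trans (ler_normB _ _))// lerD ?fM ?addr_ge0 ?mulr_ge0//.
  by rewrite normrM ger0_norm// ler_wpM2l// fM// addr_ge0.
pose S s' := [set `|f (x' + 2 * s') - 2 * f (x' + s') + f x'| | x' in `[0, +oo[%classic].
have S_ub s' : 0 < s' -> ubound (S s') (M + 2 * M + M).
  by move=> s'0 _ [x' + <-]; rewrite /= in_itv/= andbT; exact: bnd.
apply: (@le_trans _ _ (sup (S s))).
  apply: ub_le_sup; first by exists (M + 2 * M + M); exact: S_ub.
  by exists x => //=; rewrite in_itv/= x0.
apply: ub_le_sup; last by exists s => //=; rewrite in_itv/= s0.
exists (M + 2 * M + M) => _ [s' + <-]; rewrite /= in_itv/= => /andP[s'0 _].
(* Bounding the inner supremum from above also needs a point in its set, here the one for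
   [x = 0]. *)
apply: ge_sup; last exact: S_ub.
exists `|f (0 + 2 * s') - 2 * f (0 + s') + f 0|; exists 0 => //=.
by rewrite in_itv/= lexx.
Qed.

Theorem theorem4 (R : realType) :
  exists c : R, 0 < c /\
  forall (alpha mu lambda : R) (f : R -> R) (n : nat) (x : R),
    0 <= alpha -> - (1 / 2) < mu -> 0 <= lambda ->
    bounded_continuous f -> (0 < n)%N -> 0 <= x ->
    [/\ szasz_op alpha mu lambda n (fun t => t - x) x = Lambda1 alpha lambda n x,
        szasz_op alpha mu lambda n (fun t => (t - x) ^+ 2) x
          = Lambda2 alpha mu lambda n x
      & `|szasz_op alpha mu lambda n f x - f x|
          <= c * omega2 f (1 / 2 * Num.sqrt (Upsilon alpha mu lambda n x))
             + omega f (Lambda1 alpha lambda n x)].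
Proof.
(* [30 = 6 * (1 + 4)]: the factor 6 comes from the affine approximation, and 4 bounds the variance
   divided by [d ^+ 2]. *)
exists 30; split=> // alpha mu lambda f n x al mugt la bf n0 x0.
split.
- have := szasz_op_quadratic alpha mu lambda x n al mugt la n0 x0 (- x) 1 0.
  rewrite (_ : (fun t => _) = (fun t => t - x)); last by apply/funext => t; ring.
  by move=> ->; rewrite szasz_mean1E//; ring.
- have := szasz_op_quadratic alpha mu lambda x n al mugt la n0 x0 (x ^+ 2) (- (2 * x)) 1.
  rewrite (_ : (fun t => _) = (fun t => (t - x) ^+ 2)); last by apply/funext => t; ring.
  by move=> ->; rewrite -szasz_centered2E//; ring.
have [mf [M fM]] := bounded_continuousP _ f bf.
set m2 := szasz_mean2 alpha mu lambda x n.
have m1E := szasz_mean1E alpha lambda x n n0.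
set m := szasz_mean1 alpha lambda x n in m1E.
have L1 := Lambda1_gt0 alpha lambda x n al la n0 x0.
have m0 : 0 <= m by rewrite m1E addr_ge0// ltW.
have U0 := Upsilon_gt0 alpha mu lambda x n al mugt la n0 x0.
set d := 1 / 2 * Num.sqrt _.
have d0 : 0 < d by rewrite mulr_gt0 ?sqrtr_gt0.
have d2 : 4 * d ^+ 2 = Upsilon alpha mu lambda n x.
  by rewrite /d exprMn sqr_sqrtr ?ltW//; field.
set w := omega2 f d.
have diff2 s t : 0 < s -> s <= d -> 0 <= t -> `|f (t + 2 * s) - 2 * f (t + s) + f t| <= w.
  exact: le_omega2 fM.
have w0 : 0 <= w by apply: le_trans (diff2 d 0 d0 (lexx _) (lexx _)).
pose B := (f (m + d) - f m) / d.
have dn0 : d != 0 by rewrite gt_eqF.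
(* The line is written as [A + B * t] with value [f m] at the mean [m], so its average is exactly
   [f m]. The other coefficients expand [6 * w * (1 + ((t - m) / d) ^+ 2)] in powers of [t]. *)
have := szasz_op_approx alpha mu lambda x n al mugt la n0 x0 f M (f m - B * m) B
  (6 * w * (1 + m ^+ 2 / d ^+ 2)) (6 * w * (- (2 * m / d ^+ 2))) (6 * w / d ^+ 2) mf fM.
rewrite -/m -/m2 subrK => approx.
have {}approx := approx _.
have h1 : `|f m - f x| <= omega f (Lambda1 alpha lambda n x).
  apply: (le_omega _ f M) => //.
  by rewrite m1E addrC addKr gtr0_norm.
rewrite (_ : _ - f x = (szasz_op alpha mu lambda n f x - f m) + (f m - f x)); last by ring.
rewrite (le_trans (ler_normD _ _))// lerD//.
apply: (le_trans (approx _)).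
  move=> t t0; have := affine_approximation f d w M d0 fM diff2 m t m0 t0.
  rewrite -/B (_ : f m - B * m + B * t = f m + B * (t - m)); last by ring.
  by move=> /le_trans; apply; rewrite le_eqVlt; apply/orP; left; apply/eqP; field.
rewrite [leLHS](_ : _ = 6 * w * (1 + (m2 - m ^+ 2) / d ^+ 2)); last by field.
(* The variance is the mean square deviation from [x] minus the squared bias [(m - x) ^+ 2]. *)
have -> : m2 - m ^+ 2 = Lambda2 alpha mu lambda n x - Lambda1 alpha lambda n x ^+ 2.
  rewrite -(szasz_centered2E alpha mu lambda x n n0) -/m -/m2.
  have -> : Lambda1 alpha lambda n x = m - x by rewrite m1E; ring.
  by ring.
have : (Lambda2 alpha mu lambda n x - Lambda1 alpha lambda n x ^+ 2) / d ^+ 2 <= 4.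
  rewrite ler_pdivrMr ?exprn_gt0// d2 /Upsilon.
  have := sqr_ge0 (Lambda1 alpha lambda n x); lra.
by nra.
Qed.
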